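(* There is a constant $\epsilon_0>0$ such that for every $0<\epsilon\le\epsilon_0$ and all sufficiently large $n$, for all but an $o(1)$ fraction of the subsets $P\subseteq\{0,1\}^n$ with $|P|=2^{n/20}$, no quantum property tester for $P$ with distance parameter $\epsilon$ makes at most $n/400$ queries. In particular, most properties with $2^{n/20}$ elements require quantum property testers with $\Omega(n)$ queries.
   Context: $x\in\{0,1\}^n$ is $\epsilon$-far from $P$ if it differs from every element of $P$ in more than $\epsilon n$ positions. A quantum property tester for $P$ with distance parameter $\epsilon$ is a quantum algorithm accessing $x$ through the oracle $O_x:\lvert i,b,z\rangle\mapsto\lvert i,b\oplus x_i,z\rangle$ that accepts every $x\in P$ with probability $\ge2/3$ and every $\epsilon$-far $x$ with probability $\le1/3$; its complexity is the number of oracle queries. *)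

(* Defs.v *)
From HB Require Import structures.
From mathcomp Require Import all_boot all_order all_algebra.
From mathcomp Require Import boolp reals Rstruct complex.


Set Implicit Arguments.
Unset Strict Implicit.
Unset Printing Implicit Defensive.

Import Order.TTheory GRing.Theory Num.Theory.
Local Open Scope ring_scope.

Definition C : Type := complex Rdefinitions.R.

Definition bits (n : nat) := {ffun 'I_n -> bool}.

Definition hdist n (x y : bits n) : nat := #|[set i | x i != y i]|.

Definition far n (eps : Rdefinitions.R) (x : bits n) (P : {set bits n}) : Prop :=
  forall y, y \in P -> eps * n%:R < (hdist x y)%:R.

(* computational basis of the query register |i, b, z>, workspace z : 'I_m *)
Definition basis (n m : nat) : finType := ('I_n * bool * 'I_m)%type.

Definition vec (B : finType) := B -> C.
Definition op (B : finType) := B -> B -> C.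

Definition apply (B : finType) (U : op B) (v : vec B) : vec B :=
  fun y => \sum_(x : B) U y x * v x.

Definition unit_vec (B : finType) (v : vec B) : Prop :=
  \sum_(x : B) `|v x| ^+ 2 = 1.

Definition unitary (B : finType) (U : op B) : Prop :=
  forall x x' : B, \sum_(y : B) (U y x)^* * U y x' = (x == x')%:R.

Definition oracle n m (x : bits n) : op (basis n m) :=
  fun y w => ((y.1.1 == w.1.1) && (y.1.2 == w.1.2 (+) x w.1.1) && (y.2 == w.2))%:R.

Fixpoint run n m (x : bits n) (psi0 : vec (basis n m))
    (Us : nat -> op (basis n m)) (t : nat) : vec (basis n m) :=
  match t with
  | 0 => psi0
  | t'.+1 => apply (Us t') (apply (@oracle n m x) (run x psi0 Us t'))
  end.

Definition acc_prob n m (x : bits n) (psi0 : vec (basis n m))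
    (Us : nat -> op (basis n m)) (T : nat) (Acc : {set basis n m}) : C :=
  \sum_(y in Acc) `|run x psi0 Us T y| ^+ 2.

Definition has_quantum_tester n (eps : Rdefinitions.R) (P : {set bits n}) (q : Rdefinitions.R) : Prop :=
  exists (m T : nat) (psi0 : vec (basis n m)) (Us : nat -> op (basis n m))
         (Acc : {set basis n m}),
    [/\ T%:R <= q,
        unit_vec psi0,
        (forall t, (t < T)%N -> unitary (Us t)),
        (forall x, x \in P -> 2%:R / 3%:R <= acc_prob x psi0 Us T Acc)
      & (forall x, far eps x P -> acc_prob x psi0 Us T Acc <= 1 / 3%:R)].

Definition floor_pow2_n20 (n : nat) : nat :=
  \max_(k < (2 ^ n).+1 | (k ^ 20 <= 2 ^ n)%N) k.

Definition props (n : nat) : {set {set bits n}} :=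
  [set P : {set bits n} | #|P| == floor_pow2_n20 n].

Definition testable_props (n : nat) (eps : Rdefinitions.R) : {set {set bits n}} :=
  [set P in props n | `[< has_quantum_tester eps P (n%:R / 400%:R) >] ].

(* Main.v *)
(* Polynomial method plus counting. After [T] queries the acceptance probability has Fourier
   degree at most [2 T <= d = n / 200], so it is determined by [D = \sum_(j <= d) 'C(n, j)]
   coefficients. Rounding these to a grid leaves at most [2 ^ ((n + 2) * D)] functions, still
   accurate enough to separate 1/3 from 2/3. A tester for [P], [#|P| = k], thus yields a
   rounded function whose accepted set contains [P] and lies within distance [d] of [P], hence
   has at most [k * D <= 2 ^ n / 2] points; a random [P] lies inside a fixed set of that size
   with probability at most [2 ^ - k]. Since [D <= 2 ^ (H(1/200) n)] with [H(1/200) < 1/20],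
   [k = 2 ^ (n / 20)] dominates [(n + 2) * D], and the union bound concludes. *)

Require Import Defs.
From HB Require Import structures.
From mathcomp Require Import all_boot all_order all_algebra.
From mathcomp Require Import boolp reals Rstruct complex.
From mathcomp Require Import zify ring lra.

Set Implicit Arguments.
Unset Strict Implicit.
Unset Printing Implicit Defensive.

Import Order.TTheory GRing.Theory Num.Theory.
Local Open Scope ring_scope.

(** * Bit strings under xor, and Hamming weight *)

Definition bxor (n : nat) (x y : bits n) : bits n := [ffun i => x i (+) y i].

Definition bit1 (n : nat) (i : 'I_n) : bits n := [ffun j => j == i].

Definition wt (n : nat) (x : bits n) : nat := #|[set i | x i]|.

Lemma bxorC (n : nat) (x y : bits n) : bxor x y = bxor y x.
Proof. by apply/ffunP => i; rewrite !ffunE addbC. Qed.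

Lemma bxorK (n : nat) (y : bits n) : involutive (bxor y).
Proof. by move=> x; apply/ffunP => i; rewrite !ffunE addbA addbb addFb. Qed.

Lemma hdist_wt (n : nat) (x y : bits n) : hdist x y = wt (bxor x y).
Proof.
by apply: eq_card => i; rewrite !inE ffunE; case: (x i); case: (y i).
Qed.

Lemma wt0 (n : nat) : wt ([ffun=> false] : bits n) = 0%N.
Proof. by apply: eq_card0 => i; rewrite inE ffunE. Qed.

Lemma wt_bit1 (n : nat) (i : 'I_n) : wt (bit1 i) = 1%N.
Proof. by rewrite -(cards1 i); apply: eq_card => j; rewrite !inE ffunE. Qed.

Lemma wt_bxor (n : nat) (x y : bits n) : (wt x <= wt y + wt (bxor y x))%N.
Proof.
rewrite /wt; apply: leq_trans (leq_card_setU _ _); apply: subset_leq_card.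
by apply/subsetP => i; rewrite !inE ffunE; case: (x i); case: (y i).
Qed.

(** * Fourier analysis on the Boolean cube *)

Definition chi (A : comPzRingType) (n : nat) (y x : bits n) : A :=
  \prod_i (-1) ^+ (y i && x i).

Section Fourier.

Variables (F : numFieldType) (n : nat).
Implicit Types (x y z u : bits n) (f g : bits n -> F).

Lemma chi_sym x y : chi F x y = chi F y x.
Proof. by apply: eq_bigr => i _; rewrite andbC. Qed.

Lemma chi_bxor x y z : chi F (bxor y z) x = chi F y x * chi F z x.
Proof.
rewrite -big_split; apply: eq_bigr => i _ /=; rewrite ffunE -signr_addb.
by case: (y i); case: (z i); case: (x i).
Qed.

Lemma chi_bit1 i x : chi F (bit1 i) x = (-1) ^+ x i.
Proof.
rewrite /chi (bigD1 i) //= ffunE eqxx big1 ?mulr1 // => j /negPf ji.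
by rewrite ffunE ji.
Qed.

Lemma chi0 x : chi F [ffun=> false] x = 1.
Proof. by rewrite /chi big1 // => j _; rewrite ffunE. Qed.

Lemma norm_chi x y : `|chi F y x| = 1.
Proof. by rewrite normr_prod big1 // => i _; rewrite normr_sign. Qed.

(** The sum over [y] factors over coordinates, and a coordinate where [x] and [z] differ contributes
    1 - 1 = 0. *)
Lemma chi_ortho x z : \sum_y chi F y x * chi F y z = (2 ^ n)%:R * (x == z)%:R.
Proof.
transitivity (\prod_(i < n) \sum_(b : bool) (-1) ^+ (b && (x i (+) z i)) : F).
  rewrite bigA_distr_bigA; apply: eq_bigr => y _; rewrite chi_sym [chi F y z]chi_sym.
  rewrite -chi_bxor; apply: eq_bigr => i _.
  by rewrite ffunE andbC.
have [->|xz] := eqVneq x z.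
  rewrite mulr1 natrX -[in RHS](card_ord n) -prodr_const.
  by apply: eq_bigr => i _; rewrite big_bool /= addbb.
have /existsP [i xzi] : [exists i, x i != z i].
  by rewrite -negb_forall; apply: contra xz => /eqfunP h; apply/eqP/ffunP.
rewrite (bigD1 i) //= big_bool /= mulr0.
by move: xzi; case: (x i); case: (z i) => //= _; rewrite expr1 addNr mul0r.
Qed.

Definition fourier f y : F := \sum_x f x * chi F y x.

Definition lowdeg (d : nat) f : Prop := forall y, (d < wt y)%N -> fourier f y = 0.

Lemma fourier_inversion f x : (2 ^ n)%:R * f x = \sum_y fourier f y * chi F y x.
Proof.
transitivity (\sum_z f z * ((2 ^ n)%:R * (z == x)%:R)).
  rewrite (bigD1 x) //= eqxx mulr1 mulrC big1 ?addr0 // => z /negPf->.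
  by rewrite !mulr0.
under [RHS]eq_bigr => y _ do rewrite mulr_suml.
rewrite exchange_big /=; apply: eq_bigr => z _; rewrite -chi_ortho mulr_sumr.
by apply: eq_bigr => y _; rewrite mulrA.
Qed.

Lemma eq_lowdeg d f g : f =1 g -> lowdeg d f -> lowdeg d g.
Proof.
by move=> fg fd y /fd <-; apply: eq_bigr => x _; rewrite fg.
Qed.

Lemma leq_lowdeg d e f : (d <= e)%N -> lowdeg d f -> lowdeg e f.
Proof. by move=> de fd y ye; apply: fd; apply: leq_ltn_trans ye. Qed.

Lemma lowdegZ d a f : lowdeg d f -> lowdeg d (fun x => a * f x).
Proof.
move=> fd y /fd fy0; rewrite -(mulr0 a) -fy0 mulr_sumr.
by apply: eq_bigr => x _; rewrite mulrA.
Qed.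

Lemma lowdeg_sum (I : finType) (P : pred I) d (f : I -> bits n -> F) :
  (forall i, P i -> lowdeg d (f i)) -> lowdeg d (fun x => \sum_(i | P i) f i x).
Proof.
move=> fd y yd; under [LHS]eq_bigr => x _ do rewrite mulr_suml.
by rewrite exchange_big big1 // => i Pi; apply: fd.
Qed.

Lemma lowdegD d f g : lowdeg d f -> lowdeg d g -> lowdeg d (fun x => f x + g x).
Proof.
move=> fd gd y yd; transitivity (fourier f y + fourier g y).
  by rewrite -big_split; apply: eq_bigr => x _; rewrite mulrDl.
by rewrite fd // gd // addr0.
Qed.

(** Up to the factor [2 ^ n], the transform of a product is the convolution of the transforms. If
    [wt y > d + e], then for each [u] either [wt u > d] or [wt (bxor u y) > e], so every term
    vanishes. *)
Lemma lowdegM d e f g :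
  lowdeg d f -> lowdeg e g -> lowdeg (d + e) (fun x => f x * g x).
Proof.
move=> fd ge y yde; apply: (@mulfI _ (2 ^ n)%:R); first by rewrite pnatr_eq0 expn_eq0.
rewrite mulr0 mulr_sumr.
transitivity (\sum_u fourier f u * fourier g (bxor u y)).
  under eq_bigr => x _ do rewrite !mulrA fourier_inversion -mulrA mulr_suml.
  rewrite exchange_big; apply: eq_bigr => u _; rewrite mulr_sumr.
  by apply: eq_bigr => x _; rewrite chi_bxor; ring.
rewrite big1 // => u _; have [ud|du] := leqP (wt u) d; last by rewrite fd ?mul0r.
rewrite ge ?mulr0 //; have := wt_bxor y u; lia.
Qed.

Lemma lowdeg_chi u : lowdeg (wt u) (chi F u).
Proof.
move=> y; rewrite /fourier => uy.
under eq_bigr => x _ do rewrite chi_sym [chi F y x]chi_sym.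
by rewrite chi_ortho; case: eqVneq uy => [->|]; rewrite ?ltnn ?mulr0.
Qed.

(** Any function of one bit is affine in the sign (-1)^(x i), which is a character of weight 1. *)
Lemma lowdeg_bit (h : bool -> F) i : lowdeg 1 (fun x => h (x i)).
Proof.
pose a := (h false + h true) / 2; pose b := (h false - h true) / 2.
apply: (@eq_lowdeg _ (fun x => a * chi F [ffun=> false] x + b * chi F (bit1 i) x)).
  by move=> x; rewrite chi0 chi_bit1 /a /b; case: (x i); rewrite ?expr1 ?expr0; field.
apply: lowdegD; apply: lowdegZ; last by rewrite -(wt_bit1 i); apply: lowdeg_chi.
by apply: (@leq_lowdeg 0) => //; rewrite -(wt0 n); apply: lowdeg_chi.
Qed.

End Fourier.

(** * Quantum query algorithms: unit norm and polynomial degree *)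

Definition bflip (n m : nat) (x : bits n) (w : basis n m) : basis n m :=
  (w.1.1, w.1.2 (+) x w.1.1, w.2).

Lemma bflipK (n m : nat) (x : bits n) : involutive (@bflip n m x).
Proof. by case=> [[i b] z]; rewrite /bflip /= -addbA addbb addbF. Qed.

Lemma oracleE (n m : nat) (x : bits n) (y w : basis n m) :
  oracle x y w = (w == bflip x y)%:R.
Proof.
congr (nat_of_bool _)%:R; case: y => [[i b] z]; case: w => [[j c] u].
rewrite /bflip /= !xpair_eqE /= [j == i]eq_sym [u == z]eq_sym.
case: (i =P j) => //= <-; congr (_ && _).
by case: b; case: c; case: (x i).
Qed.

Lemma apply_oracle (n m : nat) (x : bits n) (v : vec (basis n m)) y :
  apply (@oracle n m x) v y = v (bflip x y).
Proof.
rewrite /apply (bigD1 (bflip x y)) //= oracleE eqxx mul1r big1 ?addr0 // => w.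
by move=> /negPf wy; rewrite oracleE wy mul0r.
Qed.

Lemma norm_apply_unitary (B : finType) (U : op B) (v : vec B) :
  unitary U -> \sum_y `|apply U v y| ^+ 2 = \sum_x `|v x| ^+ 2.
Proof.
move=> Uu.
transitivity (\sum_x \sum_x' (v x)^* * v x' * \sum_y (U y x)^* * U y x').
  under eq_bigr => y _ do rewrite normCKC /apply rmorph_sum mulr_suml.
  rewrite exchange_big; apply: eq_bigr => x _.
  under eq_bigr => y _ do rewrite mulr_sumr.
  rewrite exchange_big; apply: eq_bigr => x' _; rewrite mulr_sumr.
  by apply: eq_bigr => y _; rewrite rmorphM /=; ring.
apply: eq_bigr => x _; rewrite (bigD1 x) //= Uu eqxx mulr1 big1 ?addr0 ?normCKC //.
by move=> x' /negPf xx'; rewrite Uu eq_sym xx' mulr0.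
Qed.

Lemma norm_run (n m : nat) (x : bits n) (psi0 : vec (basis n m)) Us (t : nat) :
  unit_vec psi0 -> (forall s, (s < t)%N -> unitary (Us s)) ->
  \sum_y `|run x psi0 Us t y| ^+ 2 = 1.
Proof.
move=> psi0_unit; elim: t => [//|t IHt] Usu /=.
rewrite norm_apply_unitary; last exact: Usu.
rewrite -[RHS]IHt; last by move=> s st; apply: Usu; apply: ltnW.
rewrite (reindex_inj (can_inj (bflipK x))); apply: eq_bigr => y _.
by rewrite apply_oracle bflipK.
Qed.

Lemma acc_prob_ge0 (n m : nat) (x : bits n) (psi0 : vec (basis n m)) Us T Acc :
  0 <= acc_prob x psi0 Us T Acc.
Proof. by apply: sumr_ge0 => y _; rewrite exprn_ge0. Qed.

Lemma acc_prob_le1 (n m : nat) (x : bits n) (psi0 : vec (basis n m)) Us T Acc :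
  unit_vec psi0 -> (forall t, (t < T)%N -> unitary (Us t)) ->
  acc_prob x psi0 Us T Acc <= 1.
Proof.
move=> psi0_unit Usu; rewrite -(norm_run x psi0_unit Usu) /acc_prob.
rewrite [leRHS](bigID (mem Acc)) /= lerDl.
by apply: sumr_ge0 => y _; rewrite exprn_ge0.
Qed.

(** The unitaries do not depend on [x], and each oracle entry depends on a single bit of [x], so one
    query raises the degree by at most 1. *)
Lemma lowdeg_run (n m : nat) (psi0 : vec (basis n m)) Us (t : nat) y :
  lowdeg t (fun x => run x psi0 Us t y).
Proof.
elim: t y => [|t IHt] y /=.
  apply: (@eq_lowdeg _ _ _ (fun x => psi0 y * chi _ [ffun=> false] x)).
    by move=> x; rewrite chi0 mulr1.
  by apply: lowdegZ; rewrite -(wt0 n); apply: lowdeg_chi.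
apply: lowdeg_sum => w _; apply: lowdegZ.
apply: lowdeg_sum => u _.
rewrite -[t.+1]add1n; apply: lowdegM (IHt u).
exact: (lowdeg_bit
  (fun b => ((w.1.1 == u.1.1) && (w.1.2 == u.1.2 (+) b) && (w.2 == u.2))%:R)).
Qed.

Lemma lowdeg_conj (F : numClosedFieldType) (n d : nat) (f : bits n -> F) :
  lowdeg d f -> lowdeg d (fun x => (f x)^*).
Proof.
move=> fd y yd; transitivity ((fourier f y)^*); last by rewrite fd ?conjC0.
rewrite rmorph_sum; apply: eq_bigr => x _ /=.
rewrite rmorphM /=; congr (_ * _); rewrite rmorph_prod.
by apply: eq_bigr => i _; rewrite /= rmorph_sign.
Qed.

Lemma lowdeg_acc_prob (n m : nat) (psi0 : vec (basis n m)) Us T Acc :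
  lowdeg (T + T) (fun x => acc_prob x psi0 Us T Acc).
Proof.
apply: lowdeg_sum => y _.
apply: (@eq_lowdeg _ _ _ (fun x => run x psi0 Us T y * (run x psi0 Us T y)^*)).
  by move=> x; rewrite normCK.
by apply: lowdegM; [|apply: lowdeg_conj]; apply: lowdeg_run.
Qed.

Lemma has_quantum_tester_lowdeg (n d : nat) eps (P : {set bits n}) :
  (n %/ 200 <= d)%N -> has_quantum_tester eps P (n%:R / 400%:R) ->
  exists p : bits n -> Rdefinitions.R,
    [/\ forall x, 0 <= p x <= 1, lowdeg d p,
        forall x, x \in P -> 2 / 3 <= p x & forall x, far eps x P -> p x <= 1 / 3].
Proof.
move=> nd [m [T [psi0 [Us [Acc [Tn psi0_unit Usu accP rejP]]]]]].
pose a x := acc_prob x psi0 Us T Acc.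
(* A nonnegative complex number is real, so passing to real parts loses nothing. *)
have aE x : a x = real_complex _ (complex.Re (a x)).
  by rewrite RRe_real // ger0_real // acc_prob_ge0.
have TT_le_d : (T + T <= d)%N.
  apply: leq_trans nd; rewrite leq_divRL //.
  move: Tn; rewrite ler_pdivlMr ?ltr0n // -natrM ler_nat; lia.
have rat_real (i j : nat) : i%:R / j%:R = real_complex Rdefinitions.R (i%:R / j%:R).
  by rewrite rmorphM fmorphV !rmorph_nat.
exists (fun x => complex.Re (a x)); split=> [x|y yd|x xP|x xfar].
- rewrite -!lecR -aE rmorph0 rmorph1 acc_prob_ge0 /=.
  exact: acc_prob_le1.
- apply: (fmorph_inj (real_complex Rdefinitions.R)).
  rewrite rmorph0 -[RHS](@lowdeg_acc_prob n m psi0 Us T Acc y (leq_ltn_trans TT_le_d yd)).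
  rewrite rmorph_sum; apply: eq_bigr => x _ /=; rewrite rmorphM.
  congr (_ * _); first exact: esym (aE x).
  rewrite rmorph_prod; apply: eq_bigr => i _.
  by rewrite rmorph_sign.
- by rewrite -lecR -aE -rat_real; apply: accP.
- have := rejP x xfar; rewrite -/(a x) aE (rat_real 1 3)%N lecR; exact.
Qed.

(** * Hamming balls and rounding of Fourier coefficients *)

Definition low (n d : nat) : {set bits n} := [set y | (wt y <= d)%N].

Lemma leq_card_ball (n d : nat) (y : bits n) :
  (#|[set x | hdist x y <= d]| <= #|low n d|)%N.
Proof.
apply: leq_trans (leq_imset_card (bxor y) _); apply: subset_leq_card.
apply/subsetP => x; rewrite inE hdist_wt => xy.
by apply/imsetP; exists (bxor y x); rewrite ?bxorK // inE bxorC.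
Qed.

Lemma leq_card_bigcup (I T : finType) (P : pred I) (A : I -> {set T}) :
  (#|\bigcup_(i | P i) A i| <= \sum_(i | P i) #|A i|)%N.
Proof.
apply: (big_ind2 (fun (B : {set T}) m => #|B| <= m)%N) => [|B m C p Bm Cp|//].
  by rewrite cards0.
exact: leq_trans (leq_card_setU _ _) (leq_add Bm Cp).
Qed.

Section Rounding.

Variables (R : archiRealFieldType) (n d : nat).

(** The code [g y] stands for the integer coefficient [g y - 2 ^ n] in [-2^n, 2^n]. As [fourier] is
    unnormalised, this approximates [2 ^ n * p x] rather than [p x]. *)
Definition approx (g : {ffun bits n -> 'I_(2 ^ n.+1).+1}) (x : bits n) : R :=
  \sum_(y in low n d) ((g y)%:R - (2 ^ n)%:R) * chi R y x.

Lemma fourier_bound (p : bits n -> R) y :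
  (forall x, 0 <= p x <= 1) -> `|fourier p y| <= (2 ^ n)%:R.
Proof.
move=> p01; apply: le_trans (ler_norm_sum _ _ _) _.
have -> : (2 ^ n)%:R = \sum_(x : bits n) 1 :> R.
  by rewrite sumr_const card_ffun card_bool card_ord.
apply: ler_sum => x _; rewrite normrM norm_chi mulr1.
by have /andP [p0 p1] := p01 x; rewrite ger0_norm.
Qed.

(** Each of the [#|low n d|] coefficients is off by at most 1 and characters have modulus 1. Fixing
    [g] to [ord0] outside [low n d] keeps the number of codes small. *)
Lemma lowdeg_rounding (p : bits n -> R) :
  (forall x, 0 <= p x <= 1) -> lowdeg d p ->
  exists2 g, g \in pffun_on ord0 (low n d) predT &
    forall x, `|(2 ^ n)%:R * p x - approx g x| <= #|low n d|%:R.
Proof.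
move=> p01 pd; pose c y := fourier p y + (2 ^ n)%:R.
have c0 y : 0 <= c y by have := fourier_bound y p01; rewrite ler_norml /c; lra.
have ck y : (Num.truncn (c y) < (2 ^ n.+1).+1)%N.
  rewrite ltnS truncn_le_nat; have := fourier_bound y p01.
  by rewrite ler_norml /c -natr1 expnS natrM; lra.
exists [ffun y => if y \in low n d then inord (Num.truncn (c y)) else ord0].
  apply/pffun_onP; split=> //; apply/subsetP => y.
  by rewrite inE ffunE; case: ifP => //; rewrite eqxx.
move=> x; rewrite fourier_inversion (bigID (mem (low n d))) /=.
rewrite [X in _ + X - _]big1 ?addr0 => [|y]; last first.
  by rewrite inE -ltnNge => /pd ->; rewrite mul0r.
rewrite /approx -sumrB; apply: le_trans (ler_norm_sum _ _ _) _.
rewrite -sum1_card natr_sum; apply: ler_sum => y y_low.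
rewrite -mulrBl normrM norm_chi mulr1 ffunE y_low inordK //.
by have := truncn_itv (c0 y); rewrite ler_norml -natr1 /c; lra.
Qed.

End Rounding.

(** * Counting testable properties *)

Lemma testable_count (n k : nat) (eps : Rdefinitions.R) (D := #|low n (n %/ 200)|) :
  eps <= 1 / 200 -> (6 * D < 2 ^ n)%N ->
  (#|[set P : {set bits n} | (#|P| == k)
       && `[< has_quantum_tester eps P (n%:R / 400%:R) >]]|
     <= (2 ^ n.+1).+1 ^ D * 'C(k * D, k))%N.
Proof.
move=> eps_le D_small; set d := (n %/ 200)%N in D D_small *.
(* The threshold is 1/2 after scaling. The rounding error is below [2 ^ n / 6], the scaled distance
   from 1/2 to both 1/3 and 2/3. *)
pose accepted (g : {ffun bits n -> 'I_(2 ^ n.+1).+1}) : {set bits n} :=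
  [set x | (2 ^ n)%:R < 2 * approx Rdefinitions.R d g x].
pose codes := [pred g | (g \in pffun_on ord0 (low n d) predT)
                        && (#|accepted g| <= k * D)%N].
apply: (@leq_trans (\sum_(g | codes g)
    #|[set P : {set bits n} | (P \subset accepted g) && (#|P| == k)]|)); last first.
  apply: (@leq_trans (\sum_(g | codes g) 'C(k * D, k))).
    by apply: leq_sum => g /andP [_ g_small]; rewrite cards_draws leq_bin2l.
  rewrite sum_nat_const leq_mul2r; apply/orP; right.
  apply: (@leq_trans #|pffun_on (@ord0 (2 ^ n.+1)) (low n d) predT|).
    by apply: subset_leq_card; apply/subsetP => g /andP [].
  by rewrite card_pffun_on card_ord.
apply: leq_trans (leq_card_bigcup _ _); apply: subset_leq_card.
apply/subsetP => P; rewrite inE => /andP [/eqP Pk /asboolP].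
move=> /(has_quantum_tester_lowdeg (leqnn d)) [p [p01 pd accP rejP]].
have [g g_low g_close] := lowdeg_rounding p01 pd.
have D_small' : 6 * #|low n d|%:R < (2 ^ n)%:R :> Rdefinitions.R.
  by rewrite -natrM ltr_nat.
have P_acc : P \subset accepted g.
  apply/subsetP => x xP; rewrite inE.
  have : (2 ^ n)%:R * (2 / 3) <= (2 ^ n)%:R * p x.
    by rewrite ler_wpM2l ?ler0n //; apply: accP.
  by have := g_close x; rewrite ler_norml; lra.
have acc_near : accepted g \subset \bigcup_(y in P) [set x | (hdist x y <= d)%N].
  apply/subsetP => x; rewrite inE => xg; apply/bigcupP.
  suff [y yP xy] : exists2 y, y \in P & (hdist x y <= d)%N.
    by exists y => //; rewrite inE.
  have [//|P_far] := pselect (exists2 y, y \in P & (hdist x y <= d)%N).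
  (* A distance at most [eps * n <= n / 200] is an integer, hence at most [d]. *)
  have /rejP px : far eps x P.
    move=> y yP; rewrite ltNge; apply/negP => xy; apply: P_far; exists y => //.
    rewrite leq_divRL // -(ler_nat Rdefinitions.R) natrM.
    by have /(ler_wpM2r (ler0n _ n)) := eps_le; lra.
  have : (2 ^ n)%:R * p x <= (2 ^ n)%:R * (1 / 3) by rewrite ler_wpM2l ?ler0n.
  by have := g_close x; rewrite ler_norml; lra.
apply/bigcupP; exists g; last by rewrite inE P_acc Pk eqxx.
apply/andP; split=> //; apply: leq_trans (subset_leq_card acc_near) _.
apply: leq_trans (leq_card_bigcup _ _) _; rewrite -Pk -sum_nat_const.
by apply: leq_sum => y _; apply: leq_card_ball.
Qed.

(** * Estimates for binomials, ball sizes and growth rates *)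

Lemma leq_wexp2r (e m p : nat) : (m <= p)%N -> (m ^ e <= p ^ e)%N.
Proof. by case: e => [//|e] mp; rewrite leq_exp2r. Qed.

(** Compare falling factorials factor by factor: [2 * (M - i) <= 2 * M - i]. *)
Lemma leq_bin_double (M k : nat) : (2 ^ k * 'C(M, k) <= 'C(2 * M, k))%N.
Proof.
rewrite -(leq_pmul2r (fact_gt0 k)) -mulnA !bin_ffact.
elim: k => [|k IHk] //; rewrite !ffactnSr expnS.
by apply: leq_trans (leq_mul IHk (_ : (2 * (M - k) <= 2 * M - k)%N)); lia.
Qed.

(* Chernoff-type bound: weigh each [y] by [c ^ (n - wt y)]; these weights sum to [c.+1 ^ n]. *)
Lemma card_low_weight (n d c : nat) : (0 < c)%N ->
  (#|low n d| * c ^ n <= c ^ d * c.+1 ^ n)%N.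
Proof.
move=> c0; have wsum : (\sum_(y : bits n) c ^ (n - wt y) = c.+1 ^ n)%N.
  transitivity (\prod_(i < n) \sum_(b : bool) (if b then 1 else c))%N; last first.
    rewrite -[in RHS](card_ord n) -prod_nat_const.
    by apply: eq_bigr => i _; rewrite big_bool.
  rewrite bigA_distr_bigA; apply: eq_bigr => y _.
  have -> : (n - wt y)%N = #|[pred i | ~~ y i]|.
    rewrite -[X in (X - _)%N](card_ord n) -(cardC [set i | y i]) addKn.
    by apply: eq_card => i; rewrite !inE.
  rewrite -prod_nat_const big_mkcond; apply: eq_bigr => i _ /=.
  by rewrite inE; case: (y i).
rewrite -wsum big_distrr -sum_nat_const /=.
rewrite [leqRHS](bigID (mem (low n d))) /=; apply: leq_trans (leq_addr _ _).
apply: leq_sum => y; rewrite inE => yd; rewrite -expnD leq_pexp2l //; lia.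
Qed.

(** Raise the weight bound to the power [e]. Since [d * e <= 2 * n], the factor [c ^ (d * e)] is at
    most [(c ^ 2) ^ n], and what remains is the [n]-th power of the second hypothesis. *)
Lemma card_low_power (n d c e K : nat) : (0 < c)%N ->
  (2 * c ^ 2 * c.+1 ^ e <= K * c ^ e)%N -> (d * e <= 2 * n)%N ->
  (#|low n d| ^ e * 2 ^ n <= K ^ n)%N.
Proof.
move=> c0 key de; have := card_low_weight n d c0; move: #|_| => D hD.
rewrite -(@leq_pmul2r (c ^ (n * e))) ?expn_gt0 ?c0 //.
have -> : (D ^ e * 2 ^ n * c ^ (n * e) = (D * c ^ n) ^ e * 2 ^ n)%N.
  by rewrite expnMn expnM mulnAC.
apply: (@leq_trans ((2 * c ^ 2 * c.+1 ^ e) ^ n)).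
  have -> : ((2 * c ^ 2 * c.+1 ^ e) ^ n = c ^ (2 * n) * c.+1 ^ (e * n) * 2 ^ n)%N.
    by rewrite (expnMn _ (c.+1 ^ e)) (expnMn 2) -!expnM -mulnA mulnC.
  rewrite leq_mul2r; apply/orP; right.
  apply: (@leq_trans ((c ^ d * c.+1 ^ n) ^ e)); first exact: leq_wexp2r.
  by rewrite expnMn -!expnM (mulnC e) leq_mul2r leq_pexp2l ?orbT.
by rewrite (mulnC n e) (expnM c) -expnMn leq_wexp2r.
Qed.

(* Numerically [2 * 200 ^ 2 * (1 + 1 / 200) ^ 400 < 2 ^ 20]: this is the only place where
   the constants 1/20 and 1/400 of the theorem play against each other. *)
Lemma card_low_bound (n d : nat) : (200 * d <= n)%N ->
  (#|low n d| ^ 400 * 2 ^ n <= 2 ^ (20 * n))%N.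
Proof.
have cast (a b e K k : nat) :
    2 * a%:R ^+ 2 * b%:R ^+ e <= K%:R ^+ k * a%:R ^+ e :> Rdefinitions.R ->
    (2 * a ^ 2 * b ^ e <= K ^ k * a ^ e)%N.
  by rewrite -(ler_nat Rdefinitions.R) !natrM !natrX.
move=> dn; rewrite [leqRHS]expnM.
apply: (@card_low_power n d 200 400 (2 ^ 20)); first by [].
  by apply: cast; lra.
lia.
Qed.

(** With [m = n %/ 400] it suffices that a linear function of [m] is below [2 ^ m]; then take 400th
    powers. *)
Lemma leq_exp_linear (a : nat) :
  exists N, forall n, (N <= n)%N -> ((n + a) ^ 400 <= 2 ^ n)%N.
Proof.
exists (400 * (2 * (1200 + a)))%N => n Nn.
have h m : (2 * (1200 + a) <= m)%N -> (400 * m + 400 + a <= 2 ^ m)%N.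
  (* Squaring [h <= 2 ^ m./2] gives a quadratic lower bound on [2 ^ m]. *)
  move=> am; pose h := m./2.+1.
  have m2h : (m < 2 * h)%N by rewrite /h; lia.
  have hm : (2 * m./2 <= m)%N by lia.
  have le_h2 : (h ^ 2 <= 2 ^ m)%N.
    apply: leq_trans (leq_pexp2l (isT : 0 < 2)%N hm).
    by rewrite mulnC expnM leq_exp2r //; apply: ltn_expl.
  apply: leq_trans le_h2; have : (1200 + a < h)%N by rewrite /h; lia.
  nia.
set m := (n %/ 400)%N.
have m_ge : (2 * (1200 + a) <= m)%N by rewrite leq_divRL //; lia.
have nm : (n < 400 * m + 400)%N by rewrite /m; lia.
apply: (@leq_trans (2 ^ (m * 400))); last by rewrite leq_pexp2l // leq_trunc_div.
by rewrite expnM leq_exp2r //; apply: leq_trans (h _ m_ge); lia.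
Qed.

Lemma floor_pow2_n20_le (n : nat) : (floor_pow2_n20 n ^ 20 <= 2 ^ n)%N.
Proof.
apply: (big_ind (fun m => m ^ 20 <= 2 ^ n)%N) => // x y xn yn.
by rewrite /maxn; case: ifP.
Qed.

Lemma leq_floor_pow2_n20 (n t : nat) : (t ^ 20 <= 2 ^ n)%N -> (t <= floor_pow2_n20 n)%N.
Proof.
move=> tn; have t_lt : (t < (2 ^ n).+1)%N.
  rewrite ltnS; apply: leq_trans tn; case: t => // t.
  by rewrite -[leqLHS]expn1 leq_pexp2l.
exact: (@leq_bigmax_cond _ _ (fun i : 'I_(2 ^ n).+1 => i : nat) (Ordinal t_lt)).
Qed.

(** The spare factor [2 ^ n] in [card_low_bound] absorbs the 400th power of the linear factor. The
    slack [L] and 6 serve the final union bound and the smallness of [D]. *)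
Lemma card_low_floor (L : nat) :
  exists N, forall n, (N <= n)%N ->
    (L + (n + 6) * #|low n (n %/ 200)| <= floor_pow2_n20 n)%N.
Proof.
have lin n D : (0 < D)%N -> (L + (n + 6) * D <= (n + (L + 6)) * D)%N by nia.
have [N HN] := leq_exp_linear (L + 6); exists N => n /HN n_exp.
have := @card_low_bound n (n %/ 200).
have : (0 < #|low n (n %/ 200)|)%N.
  by apply/card_gt0P; exists [ffun=> false]; rewrite inE wt0.
move: #|_| => D D0 D_exp; apply: leq_floor_pow2_n20.
apply: (@leq_trans (((n + (L + 6)) * D) ^ 20)); first exact/leq_wexp2r/lin.
rewrite -(@leq_exp2r _ _ 20) // -!expnM (mulnC n) expnMn.
rewrite -(@leq_pmul2r (2 ^ n)) ?expn_gt0 // -mulnA mulnC.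
by apply: leq_mul n_exp; apply: D_exp; rewrite mulnC leq_trunc_div.
Qed.

Theorem theorem5p1 :
  exists eps0 : Rdefinitions.R, 0 < eps0 /\
    forall eps : Rdefinitions.R, 0 < eps -> eps <= eps0 ->
      forall delta : Rdefinitions.R, 0 < delta ->
        exists N : nat, forall n : nat, (N <= n)%N ->
          (#|testable_props n eps|%:R : Rdefinitions.R) <= delta * (#|props n|%:R).

Proof.
(* This makes the distance radius match the degree bound [n / 200], so one number [D] counts both
   Fourier coefficients and ball points. *)
exists (1 / 200); split; first lra.
move=> eps eps_gt0 eps_le delta delta_gt0.
pose L := (Num.truncn delta^-1).+1.
have L_delta : 1 <= delta * (2 ^ L)%:R.
  rewrite mulrC -ler_pdivrMr // div1r; apply: ltW; apply: lt_trans (truncnS_gt _) _.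
  by rewrite ltr_nat ltn_expl.
have [N HN] := card_low_floor L; exists N => n /HN.
have k_le := floor_pow2_n20_le n; set k := floor_pow2_n20 n in k_le * => D_le.
pose D := #|low n (n %/ 200)|; rewrite -/D in D_le.
have D0 : (0 < D)%N by apply/card_gt0P; exists [ffun=> false]; rewrite inE wt0.
(* As [6 * D < k], a cube suffices to bound both [6 * D] and [2 * (k * D)]. *)
have k_cube : (k ^ 3 <= 2 ^ n)%N.
  by apply: leq_trans k_le; rewrite leq_pexp2l //; nia.
have D_small : (6 * D < 2 ^ n)%N by apply: leq_trans k_cube; nia.
have kD_small : (2 * (k * D) <= 2 ^ n)%N by apply: leq_trans k_cube; nia.
have -> : #|props n| = 'C(2 ^ n, k).
  by rewrite card_draws card_ffun card_bool card_ord.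
have count : (2 ^ L * #|testable_props n eps| <= 'C(2 ^ n, k))%N.
  apply: leq_trans (leq_bin2l _ kD_small).
  apply: leq_trans (leq_bin_double _ _).
  have -> : testable_props n eps = [set P : {set bits n} | (#|P| == k)
       && `[< has_quantum_tester eps P (n%:R / 400%:R) >]].
    by apply/setP => P; rewrite !inE.
  apply: leq_trans (leq_mul (leqnn _) (testable_count k eps_le D_small)) _.
  rewrite mulnA leq_mul2r; apply/orP; right.
  (* Each coefficient costs at most [n + 2] bits, and [L + (n + 2) * D <= k], so the factor [2 ^ k]
     gained from doubling pays for the union bound and for [2 ^ L]. *)
  apply: (@leq_trans (2 ^ L * (2 ^ n.+2) ^ D)).
    rewrite leq_mul2l; apply/orP; right; apply: leq_wexp2r.
    by rewrite (expnS 2 n.+1) mul2n -addnn -addn1 leq_add2l expn_gt0.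
  by rewrite -expnM -expnD leq_pexp2l //; nia.
rewrite -(ler_nat Rdefinitions.R) natrM in count.
apply: le_trans (ler_wpM2l (ltW delta_gt0) count).
by rewrite mulrA ler_peMl.
Qed.
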